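(* For fixed $k\in\{1,\dots,n-1\}$, the number of intervals $[\sigma_k,w]_{\mathrm{wk}}$ (with $w\in\mathfrak{S}_n$, $\sigma_k\le_{\mathrm{wk}}w$) in the weak order on $\mathfrak{S}_n$ that are lattices is $n!/2$.
   Context: $\mathfrak{S}_n$ is the symmetric group with Coxeter generators $\sigma_1,\dots,\sigma_{n-1}$, where $\sigma_i$ is the transposition swapping $i$ and $i+1$. A reduced decomposition of $w$ is a word of minimal length in these generators with product $w$. (Right) weak order: $v\le_{\mathrm{wk}}w$ if some reduced decomposition of $v$ is a prefix of a reduced decomposition of $w$. $[v,w]_{\mathrm{wk}}=\{u: v\le_{\mathrm{wk}}u\le_{\mathrm{wk}}w\}$ for $v\le_{\mathrm{wk}}w$. *)

(* Defs.v *)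
From mathcomp Require Import all_boot all_fingroup.
From mathcomp Require Import boolp.

Set Implicit Arguments.
Unset Strict Implicit.
Unset Printing Implicit Defensive.

Local Open Scope group_scope.

Section WeakOrder.

Variable n : nat.

Lemma sigma_subproof (i : 'I_n.-1) : i.+1 < n.
Proof. by rewrite -ltn_predRL. Qed.

(* Points and generators are numbered from 0: [sigma i] swaps [i] and [i.+1],  *)
(* so [sigma 0], ..., [sigma (n - 2)] are the Coxeter generators usually       *)
(* written sigma_1, ..., sigma_{n-1}.                                          *)
Definition sigma (i : 'I_n.-1) : 'S_n :=
  tperm (widen_ord (leq_pred n) i) (Ordinal (sigma_subproof i)).

(* The product of 'S_n composes from left to right. With the other convention  *)
(* a word evaluates to the inverse permutation; as inversion fixes every       *)
(* [sigma i], it is an isomorphism between the two resulting prefix orders     *)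
(* that fixes the generators.                                                  *)
Definition word_prod (s : seq 'I_n.-1) : 'S_n := \prod_(i <- s) sigma i.

Definition reduced_decomposition (w : 'S_n) (s : seq 'I_n.-1) : Prop :=
  word_prod s = w /\
  forall t : seq 'I_n.-1, word_prod t = w -> size s <= size t.

Definition weak_le (v w : 'S_n) : Prop :=
  exists s t : seq 'I_n.-1,
    [/\ reduced_decomposition v s, reduced_decomposition w t & prefix s t].

Definition weak_interval (v w : 'S_n) : {set 'S_n} :=
  [set u | `[< weak_le v u /\ weak_le u w >]].

End WeakOrder.

Section InducedLattice.

Variables (T : finType) (le : T -> T -> Prop) (A : {set T}).

Definition is_meet_in (x y m : T) : Prop :=
  [/\ m \in A, le m x, le m y &
      forall z, z \in A -> le z x -> le z y -> le z m].

Definition is_join_in (x y j : T) : Prop :=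
  [/\ j \in A, le x j, le y j &
      forall z, z \in A -> le x z -> le y z -> le j z].

(* [A], with the order induced by [le], is a lattice; meets and joins are      *)
(* computed in [A], not in the ambient poset.                                  *)
Definition is_lattice_on : Prop :=
  forall x y, x \in A -> y \in A ->
    (exists m, is_meet_in x y m) /\ (exists j, is_join_in x y j).

End InducedLattice.

(* Main.v *)
(* Under the product convention of the definitions, the weak order is inclusion
   of the sets of pairs of positions that are inverted.  The transitive closure
   of a union of two inversion sets is again an inversion set: if x < y < z, an
   increasing path from x to z visits y or has a step over it, which one of the
   two sets splits at y.  Multiplying by the longest element complements
   inversion sets, so joins and meets exist and every interval is a lattice.
   An interval determines its top element, and sigma_k is below w exactly when w
   inverts (k, k+1); left multiplication by sigma_k exchanges these w with the others, so they are half of S_n. *)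
Require Import Defs.
From mathcomp Require Import all_boot all_fingroup.
From mathcomp Require Import boolp.
From mathcomp Require Import zify.

Set Implicit Arguments.
Unset Strict Implicit.
Unset Printing Implicit Defensive.

Local Open Scope group_scope.

(** * Inversion sets under right multiplication by a generator *)

Section Inversions.

Variable n : nat.
Implicit Types (u v w : 'S_n) (x y z : 'I_n) (s t r : seq 'I_n.-1).

Definition inversions w : {set 'I_n * 'I_n} :=
  [set p : 'I_n * 'I_n | (p.1 < p.2) && (w p.2 < w p.1)].

Lemma in_inversions w x y : ((x, y) \in inversions w) = (x < y) && (w y < w x).
Proof. by rewrite inE. Qed.

Let lo (i : 'I_n.-1) : 'I_n := widen_ord (leq_pred n) i.
Let hi (i : 'I_n.-1) : 'I_n := Ordinal (sigma_subproof i).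

Lemma perm_ord_eqE w x y : (w x == w y :> nat) = (x == y :> nat).
Proof. by rewrite !val_eqE (inj_eq perm_inj). Qed.

Lemma perm_ltn_total w x y : (x < y) -> (w x < w y) = ~~ (w y < w x).
Proof. by move=> lt_xy; have := perm_ord_eqE w x y; lia. Qed.

(** Right multiplication by [sigma i] exchanges the consecutive values [i] and [i.+1], so only the
    two positions holding them change relative order. *)
Lemma inversions_mul_sigma v i : v^-1 (lo i) < v^-1 (hi i) ->
  inversions (v * sigma i) = (v^-1 (lo i), v^-1 (hi i)) |: inversions v.
Proof.
move=> asc; apply/setP => -[x y]; rewrite in_setU1 !in_inversions !permM xpair_eqE.
have E z c : (z == v^-1 c) = (v z == c).
  by apply/eqP/eqP => [->|<-]; rewrite ?permKV ?permK.
have [Ex1 Ex2] := (E x (lo i), E x (hi i)).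
have [Ey1 Ey2] := (E y (lo i), E y (hi i)).
have Exy := perm_ord_eqE v x y.
rewrite -!val_eqE /= in Ex1 Ex2 Ey1 Ey2; rewrite !E -!val_eqE /=.
have tp c : sigma i c =
    (if c == i :> nat then i.+1 else if c == i.+1 :> nat then nat_of_ord i else c) :> nat.
  rewrite /sigma; case: tpermP => [->|->|/eqP] /=; rewrite ?eqxx //.
    by rewrite gtn_eqF.
  by rewrite -val_eqE /= => /negPf -> /eqP; rewrite -val_eqE /= => /negPf ->.
rewrite !tp; clear E tp.
(* What remains is arithmetic: [a] and [b] are the positions of the values [i] and [i.+1], and each
   of [vx], [vy] is one of these values or neither. *)
move: (nat_of_ord (v x)) (nat_of_ord (v y)) (nat_of_ord x) (nat_of_ord y)
  (nat_of_ord (v^-1 (lo i))) (nat_of_ord (v^-1 (hi i))) (nat_of_ord i)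
  asc Ex1 Ex2 Ey1 Ey2 Exy => {v x y i} vx vy x y a b i.
case: (eqVneq vx i) => [->|nx1]; last case: (eqVneq vx i.+1) => [->|nx2];
  (case: (eqVneq vy i) => [->|ny1]; last case: (eqVneq vy i.+1) => [->|ny2]);
  lia.
Qed.

Lemma inversions_mul_sigma_notin v i :
  (v^-1 (lo i), v^-1 (hi i)) \notin inversions v.
Proof. by rewrite in_inversions !permKV /=; lia. Qed.

Lemma card_inversions_asc v i : v^-1 (lo i) < v^-1 (hi i) ->
  #|inversions (v * sigma i)| = #|inversions v|.+1.
Proof.
move=> asc.
by rewrite inversions_mul_sigma // cardsU1 inversions_mul_sigma_notin.
Qed.

Lemma card_inversions_desc v i : ~~ (v^-1 (lo i) < v^-1 (hi i)) ->
  #|inversions v| = #|inversions (v * sigma i)|.+1.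
Proof.
move=> desc; rewrite -(@card_inversions_asc _ i); first by rewrite -mulgA tperm2 mulg1.
rewrite invMg !permM tpermV tpermL tpermR ltn_neqAle leqNgt desc andbT.
by rewrite perm_ord_eqE /= gtn_eqF.
Qed.

(** * Words, length and the weak order *)

Lemma word_prod_cons i r : word_prod (i :: r) = sigma i * word_prod r.
Proof. exact: big_cons. Qed.

Lemma word_prod_cat s t : word_prod (s ++ t) = word_prod s * word_prod t.
Proof. exact: big_cat. Qed.

Lemma card_inversions_mul_word v r :
  #|inversions (v * word_prod r)| <= #|inversions v| + size r.
Proof.
elim: r v => [|i r IH] v; first by rewrite /word_prod big_nil mulg1 addn0.
rewrite word_prod_cons mulgA; apply: leq_trans (IH _) _; rewrite [size (_ :: _)]/=.
case: (boolP (v^-1 (lo i) < v^-1 (hi i))) =>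
  [/card_inversions_asc->|/card_inversions_desc->].
  by rewrite addSnnS.
by rewrite addSn addnS !leqW.
Qed.

(** Each letter changes the number of inversions by exactly one, so equality forces every letter to
    be an ascent, and ascents only add pairs. *)
Lemma sub_inversions_mul_word v r :
  #|inversions (v * word_prod r)| = #|inversions v| + size r ->
  inversions v \subset inversions (v * word_prod r).
Proof.
elim: r v => [|i r IH] v; first by rewrite /word_prod big_nil mulg1.
rewrite word_prod_cons mulgA [size (_ :: _)]/= => Er.
case: (boolP (v^-1 (lo i) < v^-1 (hi i))) => [asc|/card_inversions_desc].
  apply: subset_trans (IH _ _); last by rewrite Er card_inversions_asc // addSnnS.
  by rewrite inversions_mul_sigma // subsetUr.
have := card_inversions_mul_word (v * sigma i) r; rewrite Er => le_r Ev; lia.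
Qed.

Lemma inversions1 : inversions 1 = set0.
Proof. by apply/setP => -[x y]; rewrite in_inversions !perm1 inE; lia. Qed.

(** An increasing [u] satisfies [x <= u x] by induction from the bottom and [u x <= x] by induction
    from the top. *)
Lemma perm_no_descent u : (forall i, u (lo i) < u (hi i)) -> u = 1.
Proof.
move=> asc.
have ge x : x <= u x.
  case: x => m; elim: m => // m IH lt_m /=.
  have lt_m' : m < n.-1 by lia.
  apply: leq_ltn_trans (IH (ltnW lt_m)) _; have := asc (Ordinal lt_m').
  rewrite (_ : lo _ = Ordinal (ltnW lt_m)); last exact: val_inj.
  by rewrite (_ : hi _ = Ordinal lt_m) //; apply: val_inj.
have le x : u x <= x.
  suff le_d d y : n - y = d -> u y <= y by exact: le_d.
  elim: d y => [|d IH] y Ey; first by have := ltn_ord y; lia.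
  case: (ltnP y n.-1) => [lt_y|]; last by have := ltn_ord (u y); lia.
  have := asc (Ordinal lt_y).
  have := IH (hi (Ordinal lt_y)).
  by rewrite (_ : lo _ = y); [move=> /=; lia | apply: val_inj].
by apply/permP => x; rewrite perm1; apply/val_inj/eqP; rewrite eqn_leq ge le.
Qed.

(* A descent of [v^-1 * w] is an ascent of [v^-1], since [v] inverts no more
   than [w]; appending it to [v] adds a single inversion, one of [w]. *)
Lemma sub_inversions_word v w : inversions v \subset inversions w ->
  exists2 r, w = v * word_prod r & #|inversions w| = #|inversions v| + size r.
Proof.
have [m] := ubnP (#|inversions w| - #|inversions v|).
elim: m v => // m IH v le_m sub_vw.
case: (pselect (forall i, (v^-1 * w)%g (lo i) < (v^-1 * w)%g (hi i))) => [asc|].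
  exists [::]; rewrite ?addn0 /word_prod ?big_nil ?mulg1;
    by rewrite -[w](mulKVg v) (perm_no_descent asc) mulg1.
move/existsNP => [i /negP]; rewrite !permM => desc.
have asc : v^-1 (lo i) < v^-1 (hi i).
  rewrite ltn_neqAle perm_ord_eqE /= ltn_eqF //= leqNgt.
  apply/negP => lt_hl; have: (v^-1 (hi i), v^-1 (lo i)) \in inversions w.
    by apply: (subsetP sub_vw); rewrite in_inversions lt_hl !permKV /=.
  by rewrite in_inversions (negPf desc) andbF.
have sub_vsw : inversions (v * sigma i) \subset inversions w.
  rewrite inversions_mul_sigma // subUset sub_vw sub1set in_inversions asc.
  by move: desc; rewrite perm_ltn_total // negbK => ->.
have Ec := card_inversions_asc asc; have le_c := subset_leq_card sub_vsw.
have [|r Ew Er] := IH (v * sigma i) _ sub_vsw; first by lia.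
by exists (i :: r); [rewrite word_prod_cons mulgA | rewrite Er Ec addSnnS].
Qed.

Lemma inversions_inj : injective inversions.
Proof.
move=> v w E; have [|r Ew Er] := @sub_inversions_word v w; first by rewrite E.
have /size0nil r0 : size r = 0.
  by apply: (@addnI #|inversions v|); rewrite addn0 -Er E.
by rewrite Ew r0 /word_prod big_nil mulg1.
Qed.

(** A word has at least as many letters as its product has inversions; building [w] up from the
    identity attains this bound. *)
Lemma reduced_decompositionE w s :
  reduced_decomposition w s <-> word_prod s = w /\ size s = #|inversions w|.
Proof.
have le_inv t : #|inversions (word_prod t)| <= size t.
  by have := card_inversions_mul_word 1 t; rewrite mul1g inversions1 cards0.
split=> [[Ew min_s]|[Ew Es]]; split=> //; last by move=> t Et; rewrite Es -Et.
have [|t Et st] := @sub_inversions_word 1 w; first by rewrite inversions1 sub0set.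
rewrite mul1g in Et; rewrite inversions1 cards0 in st.
by apply/eqP; rewrite eqn_leq st min_s //= -st -Ew le_inv.
Qed.

Lemma weak_leE v w : weak_le v w <-> inversions v \subset inversions w.
Proof.
split=> [[s [t []]]|sub_vw].
  move=> /reduced_decompositionE[Es ss] /reduced_decompositionE[Et st].
  case/prefixP => r Er; rewrite Er word_prod_cat Es in Et.
  (* Both words are reduced, so the suffix [r] raises the number of inversions by its full
     length. *)
  rewrite -Et; apply: sub_inversions_mul_word.
  by rewrite Et -ss -st Er size_cat.
have [|s Es ss] := @sub_inversions_word 1 v; first by rewrite inversions1 sub0set.
have [r Er sr] := sub_inversions_word sub_vw.
rewrite mul1g in Es; rewrite inversions1 cards0 in ss.
exists s, (s ++ r); split; last exact: prefix_prefix.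
  by apply/reduced_decompositionE.
apply/reduced_decompositionE; rewrite word_prod_cat -Es -Er size_cat.
by split=> //; rewrite sr ss.
Qed.

(** * Inversion sets from total orders, and joins *)

Lemma perm_of_total_order (R : rel 'I_n) :
    irreflexive R -> transitive R -> (forall x y, x != y -> R x y || R y x) ->
  exists u : 'S_n, forall x y, (u x < u y) = R x y.
Proof.
move=> irrR trR totR.
have lt_n x : #|[set z | R z x]| < n.
  rewrite -[ltnRHS]card_ord -cardsT; apply: proper_card.
  by apply/properP; split; [exact: subsetT | exists x; rewrite inE // irrR].
(* The permutation sends [x] to its rank, the number of elements strictly [R]-below it. *)
pose rk x := Ordinal (lt_n x).
have rk_lt x y : R x y -> rk x < rk y.
  move=> Rxy; apply: proper_card; apply/properP; split.
    by apply/subsetP => z; rewrite !inE => /trR; apply.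
  by exists x; rewrite inE // irrR.
have rk_inj : injective rk.
  move=> x y E; apply/eqP; apply/negPn/negP => /totR /orP[] /rk_lt;
    by rewrite E ltnn.
exists (perm rk_inj) => x y; rewrite !permE.
apply/idP/idP => [lt_xy|/rk_lt //].
case: (eqVneq x y) lt_xy => [->|/totR /orP[//|/rk_lt]]; first by rewrite ltnn.
by move=> lt_yx lt_xy; have := ltn_trans lt_xy lt_yx; rewrite ltnn.
Qed.

Section CoclosedClosure.

Variable e : rel 'I_n.
Hypothesis e_lt : forall x y, e x y -> x < y.
Hypothesis e_coclosed : forall x y z, x < y -> y < z -> e x z -> e x y || e y z.

Lemma connect_coclosed x y z :
  x < y -> y < z -> connect e x z -> connect e x y || connect e y z.
Proof.
move=> lt_xy lt_yz /connectP[p ep Ez]; rewrite {}Ez in lt_yz *.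
elim: p x lt_xy lt_yz ep => [|a p IH] x lt_xy /=; first by move=> *; lia.
move=> lt_yz /andP[e_xa ep].
case: (ltngtP a y) => [lt_ay|lt_ya|/val_inj <-]; last by rewrite connect1.
  case/orP: (IH a lt_ay lt_yz ep) => [/(connect_trans (connect1 e_xa)) -> //|->].
  exact: orbT.
(* The step from [x] to [a] passes over [y]. If its second half is an edge, the path goes on from
   [a] along [p]. *)
case/orP: (e_coclosed lt_xy lt_ya e_xa) => /connect1 c; first by rewrite c.
by apply/orP; right; apply: connect_trans c _; apply/connectP; exists p.
Qed.

Lemma coclosed_inversions :
  exists u, forall x y, ((x, y) \in inversions u) = (x < y) && connect e x y.
Proof.
(* [R] is the natural order with exactly the connected pairs reversed, so ranking by [R] inverts
   just these. *)
pose R x y := ((x < y) && ~~ connect e x y) || ((y < x) && connect e y x).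
have [||x y|u Eu] := @perm_of_total_order R.
- by move=> x; rewrite /R ltnn.
(* Two natural steps compose by [connect_coclosed], two reversed ones by transitivity of [connect];
   the mixed cases use one or the other according to the order of [x] and [z]. *)
- move=> y x z; rewrite /R.
  have T a b c := @connect_trans _ e b a c.
  case/orP=> /andP[xy cxy]; case/orP=> /andP[yz cyz].
  + have xz : x < z by lia.
    rewrite xz /=; apply/orP; left; apply/negP => /(connect_coclosed xy yz).
    by rewrite (negPf cxy) (negPf cyz).
  + case: (ltngtP x z) => [xz|zx|/val_inj E] /=; last by rewrite E cyz in cxy.
      by rewrite orbF; apply: contra cxy => cxz; apply: T cxz cyz.
    by have := connect_coclosed zx xy cyz; rewrite (negPf cxy) orbF.
  + case: (ltngtP x z) => [xz|zx|/val_inj E] /=; last by rewrite -E cxy in cyz.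
      by rewrite orbF; apply: contra cyz => cxz; apply: T cxy cxz.
    by have := connect_coclosed yz zx cxy; rewrite (negPf cyz).
  + by rewrite (T _ _ _ cyz cxy) (ltn_trans yz xy) orbT.
- by rewrite /R neq_ltn => /orP[] xy; rewrite xy (ltnNge _ _) (ltnW xy) /= ?orbF ?orNb ?orbN.
exists u => x y; rewrite in_inversions Eu /R.
by case: (ltnP x y) => //= xy; rewrite ltnNge (ltnW xy).
Qed.

End CoclosedClosure.

Lemma inversions_trans w x y z : (x, y) \in inversions w ->
  (y, z) \in inversions w -> (x, z) \in inversions w.
Proof. by rewrite !in_inversions; lia. Qed.

(** An inversion set is transitive, so it contains the closure of the union as soon as it contains
    the union. Taking [z := u] recovers that [u] is an upper bound. *)
Lemma inversions_join v w : exists u, forall z : 'S_n,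
  (inversions u \subset inversions z) =
  (inversions v \subset inversions z) && (inversions w \subset inversions z).
Proof.
pose e x y := ((x, y) \in inversions v :|: inversions w).
have e_lt x y : e x y -> x < y.
  by rewrite /e inE !in_inversions => /orP[] /andP[].
have [x y z xy yz|u Eu] := @coclosed_inversions e.
  (* If a permutation inverts [(x, z)], the value at [y] cannot be both above the value at [x] and
     below that at [z]. *)
  by rewrite /e !inE /= xy yz (ltn_trans xy yz) /=; lia.
exists u => z; rewrite -subUset; apply/idP/idP => /subsetP sub; apply/subsetP => -[x y].
  move=> exy; apply: sub; rewrite Eu (e_lt _ _ exy); exact: connect1.
rewrite Eu => /andP[xy /connectP[p ep Ey]]; rewrite {}Ey in xy *.
case: p ep xy => [|a p] /=; first by rewrite ltnn.
case/andP=> /sub exa ep _; elim: p a exa ep => //= b p IH a xa /andP[/sub ab].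
by apply: IH; apply: inversions_trans ab.
Qed.

(** * Meets by duality, and lattice intervals *)

Definition longest : 'S_n := perm (@rev_ord_inj n).

Lemma inversions_mul_longest v w :
  (inversions (v * longest) \subset inversions (w * longest)) =
  (inversions w \subset inversions v).
Proof.
have E u x y : ((x, y) \in inversions (u * longest)) =
    (x < y) && ((x, y) \notin inversions u).
  rewrite !in_inversions !permM !permE /=; case: (ltnP x y) => //= xy.
  by rewrite -perm_ltn_total //; have := ltn_ord (u x); have := ltn_ord (u y); lia.
apply/subsetP/subsetP => sub [x y]; last first.
  by rewrite !E => /andP[-> ]; apply: contra => /sub.
move=> w_xy; have := sub (x, y); rewrite !E w_xy andbF => sub_xy.
have xy : x < y by move: w_xy; rewrite in_inversions => /andP[].
by move: sub_xy; rewrite xy /=; case: (_ \in _) => // /(_ isT).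
Qed.

Lemma inversions_meet v w : exists u, forall z : 'S_n,
  (inversions z \subset inversions u) =
  (inversions z \subset inversions v) && (inversions z \subset inversions w).
Proof.
have [u Eu] := inversions_join (v * longest) (w * longest).
(* Multiplication by [longest] reverses inclusions, so the join of the images is carried back to the
   meet. *)
exists (u * longest^-1) => z.
by rewrite -inversions_mul_longest mulgKV Eu !inversions_mul_longest.
Qed.

Lemma in_weak_interval v w u : (u \in weak_interval v w) =
  (inversions v \subset inversions u) && (inversions u \subset inversions w).
Proof.
rewrite inE; apply/asboolP/andP => -[].
  by move=> /weak_leE ? /weak_leE.
by move=> /weak_leE ? /weak_leE.
Qed.

(** Meets and joins taken in the whole order stay between [v] and [w]. *)
Lemma weak_interval_lattice v w : is_lattice_on (@weak_le n) (weak_interval v w).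
Proof.
move=> x y; rewrite !in_weak_interval => /andP[vx xw] /andP[vy yw]; split.
  have [m Em] := inversions_meet x y.
  have /andP[mx my] : (inversions m \subset inversions x) &&
    (inversions m \subset inversions y) by rewrite -Em.
  exists m; split; try exact/weak_leE.
    by rewrite in_weak_interval Em vx vy (subset_trans mx).
  by move=> z _ /weak_leE zx /weak_leE zy; apply/weak_leE; rewrite Em zx.
have [j Ej] := inversions_join x y.
have /andP[xj yj] : (inversions x \subset inversions j) &&
  (inversions y \subset inversions j) by rewrite -Ej.
exists j; split; try exact/weak_leE.
  by rewrite in_weak_interval Ej xw yw (subset_trans vx).
by move=> z _ /weak_leE xz /weak_leE yz; apply/weak_leE; rewrite Ej xz.
Qed.

(** * Counting intervals by their tops *)

Lemma weak_interval_top_inj v :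
  {in [pred w | inversions v \subset inversions w] &, injective (weak_interval v)}.
Proof.
(* Being above [v] places each top in its own interval, hence in the other; tops not above [v] would
   all give the empty interval. *)
move=> w w'; rewrite !inE => vw vw' E; apply/inversions_inj/eqP.
have: w \in weak_interval v w' by rewrite -E in_weak_interval vw subxx.
have: w' \in weak_interval v w by rewrite E in_weak_interval vw' subxx.
rewrite !in_weak_interval => /andP[_ w'w] /andP[_ ww'].
by rewrite eqEsubset ww'.
Qed.

Lemma sub_inversions_sigma k w :
  (inversions (sigma k) \subset inversions w) = (w (hi k) < w (lo k)).
Proof.
rewrite -[sigma k]mul1g inversions_mul_sigma invg1 ?perm1 //=.
by rewrite inversions1 setU0 sub1set in_inversions /= ltnSn.
Qed.

Lemma card_inverting_sigma k : #|[set w : 'S_n | w (hi k) < w (lo k)]|.*2 = n`!.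
Proof.
set A := [set _ | _]; have <- : #|A| + #|~: A| = n`! by rewrite cardsC card_Sn.
(* Left multiplication by [sigma k] swaps the values at positions [k] and [k.+1], so it carries the
   complement of [A] onto [A]. *)
rewrite -addnn -[X in _ = _ + X](card_imset _ (mulgI (sigma k))); congr addn.
apply: eq_card => w; rewrite -[w in RHS](mulKVg (sigma k)) tpermV.
rewrite mem_imset; last exact: mulgI.
by rewrite !inE !permM tpermL tpermR [in RHS]perm_ltn_total ?negbK /=.
Qed.

End Inversions.

Theorem proposition5p7 (n : nat) (k : 'I_n.-1) :
  #|[set weak_interval (sigma k) w | w : 'S_n &
      `[< weak_le (sigma k) w /\
          is_lattice_on (@weak_le n) (weak_interval (sigma k) w) >]]|
  = n`! %/ 2.
Proof.
rewrite card_in_imset => [|w w'].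
  rewrite divn2 -(card_inverting_sigma k) doubleK; apply: eq_card => w.
  rewrite !inE -sub_inversions_sigma; apply/asboolP/idP => [[/weak_leE //]|kw].
  by split; [apply/weak_leE | apply: weak_interval_lattice].
rewrite !inE => /asboolP[/weak_leE kw _] /asboolP[/weak_leE kw' _].
exact: weak_interval_top_inj.
Qed.
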